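(* Let $\Gamma$ be a countable weakly branch group acting faithfully on a rooted spherically symmetric tree $\mathsf{T}$, and let $\mu$ be an ergodic IRS of $\Gamma$. Then there exist numbers $(m_i)$, each $m_i\in\mathbb{N}$, such that $\mu$-a.e. subgroup $H$ satisfies $$H\ge\bigoplus_{x\in I_{\mathrm{Fix}(H)}}\left[\mathrm{Rist}_{m_{|x|}}^{\Gamma}(\mathsf{T}_x),\mathrm{Rist}_{m_{|x|}}^{\Gamma}(\mathsf{T}_x)\right],$$ where $\mathrm{Fix}(H)=\{z\in\partial\mathsf{T}: z\cdot h=z\text{ for all }h\in H\}$ is the fixed point set of $H$ on the boundary $\partial\mathsf{T}$ and $I_{\mathrm{Fix}(H)}$ is the set of vertices indexing the maximal cylinders in $\partial\mathsf{T}\setminus\mathrm{Fix}(H)$.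
   Context: An IRS of a countable group $\Gamma$ is a Borel probability measure on $\mathrm{Sub}(\Gamma)\subset\{0,1\}^\Gamma$ invariant under conjugation; ergodic means ergodic for the conjugation action. Let $\mathbf{d}=(d_j)_{j\ge1}$ be integers $d_j\ge2$. The spherically symmetric rooted tree $\mathsf{T}=\mathsf{T}_{\mathbf d}$ has vertices the finite words $v=v_1\ldots v_n$, $v_j\in\{0,\ldots,d_j-1\}$ (the root is the empty word), with edges joining $v_1\ldots v_n$ and $v_1\ldots v_nv_{n+1}$; $|v|=n$ is the level of $v$. The boundary $\partial\mathsf{T}$ is the space of infinite words (rays); $C_x\subseteq\partial\mathsf{T}$ is the cylinder of rays with prefix $x$; $\mathsf{T}_x$ is the subtree rooted at $x$. Groups act on the right by rooted tree automorphisms, and hence on $\partial\mathsf{T}$. The rigid vertex stabilizer of $u$ is $\mathrm{Rist}_\Gamma(u)=\{g\in\Gamma: z\cdot g=z\ \forall z\in\partial\mathsf{T}\setminus C_u\}$. The level $m$ rigid stabilizer of the subtree $\mathsf{T}_x$ is $\mathrm{Rist}_m^\Gamma(\mathsf{T}_x)=\prod_{u_1\ldots u_m}\mathrm{Rist}_\Gamma(xu_1\ldots u_m)$, the product over all words with $u_j\in\{0,\ldots,d_{|x|+j}-1\}$, $1\le j\le m$. $\Gamma$ is weakly branch if it acts transitively on each level of $\mathsf{T}$ and $\mathrm{Rist}_\Gamma(u)$ is non-trivial for every vertex $u$. For a closed set $K\subseteq\partial\mathsf{T}$, $I_K$ is the set of vertices $x$ such that $C_x$ is a maximal cylinder contained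 in $\partial\mathsf{T}\setminus K$ (that is, $C_x\cap K=\emptyset$ and either $x$ is the root or the cylinder of the parent of $x$ meets $K$); thus $\partial\mathsf{T}\setminus K$ is the disjoint union of the $C_x$, $x\in I_K$. *)

(* Defs.v *)
From HB Require Import structures.
From mathcomp Require Import all_boot.
From mathcomp Require Import boolp classical_sets cardinality reals ereal.
From mathcomp Require Import topology measure.

Set Implicit Arguments.
Unset Strict Implicit.
Unset Printing Implicit Defensive.

Local Open Scope classical_set_scope.
Local Open Scope group_scope.

Section SphericallySymmetricTree.

(* Letters are indexed from 0: [d j] is the number of letters available in
   position [j], that is, d_(j+1) in the notation v = v_1 v_2 ... *)
Variable d : nat -> nat.

Definition is_word (w : seq nat) : bool :=
  all (fun j => nth 0 w j < d j) (iota 0 (size w)).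

Lemma is_wordP (w : seq nat) :
  reflect (forall j, j < size w -> nth 0 w j < d j) (is_word w).
Proof.
apply: (iffP allP) => h j.
  by move=> jw; apply: h; rewrite mem_iota.
by rewrite mem_iota => /andP[_ jw]; apply: h.
Qed.

Definition vertex := {w : seq nat | is_word w}.

Definition Vertex (w : seq nat) (ww : is_word w) : vertex :=
  exist (fun w => is_true (is_word w)) w ww.

Definition level (v : vertex) : nat := size (val v).

Definition root : vertex := @Vertex [::] isT.

Definition edge (u v : vertex) : Prop :=
  (exists i, val v = rcons (val u) i) \/ (exists i, val u = rcons (val v) i).

Lemma is_word_take n (v : vertex) : is_word (take n (val v)).
Proof.
apply/is_wordP => j; rewrite size_take_min leq_min => /andP[jn jv].
by rewrite nth_take//; move/is_wordP: (valP v); apply.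
Qed.

Definition vtake n (v : vertex) : vertex := Vertex (is_word_take n v).

(* The parent of the root is, by convention, the root. *)
Definition parent (v : vertex) : vertex := vtake (level v).-1 v.

Lemma val_parent (v : vertex) : val (parent v) = take (level v).-1 (val v).
Proof. by []. Qed.

Definition ray := forall j : nat, 'I_(d j).

Lemma is_word_trunc (z : ray) n : is_word (mkseq (fun j => val (z j)) n).
Proof.
apply/is_wordP => j; rewrite size_mkseq => jn; rewrite nth_mkseq//.
exact: ltn_ord.
Qed.

Definition trunc (z : ray) n : vertex := Vertex (is_word_trunc z n).

Definition cylinder (x : vertex) : set ray := [set z | trunc z (level x) = x].

(* The index set I_K of the maximal cylinders in the complement of K. *)
Definition max_cylinders (K : set ray) : set vertex :=
  [set x | cylinder x `&` K = set0 /\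
           (x = root \/ cylinder (parent x) `&` K !=set0)].

(* The words u_1 ... u_m that can be appended to a vertex of level n. *)
Definition subword n m := {dffun forall j : 'I_m, 'I_(d (n + j))}.

Lemma is_word_extend (x : vertex) m (u : subword (level x) m) :
  is_word (val x ++ [seq val (u j) | j <- enum 'I_m]).
Proof.
apply/is_wordP => j; rewrite size_cat size_map size_enum_ord nth_cat => jxm.
case: (ltnP j (size (val x))) => [jx|xj]; first by move/is_wordP: (valP x); apply.
have jm : j - size (val x) < m by rewrite ltn_subLR.
rewrite (nth_map (Ordinal jm)) ?size_enum_ord//.
set k := nth _ _ _; have -> : j = level x + k.
  by rewrite /k nth_enum_ord// subnKC.
exact: ltn_ord.
Qed.

Definition extend (x : vertex) m (u : subword (level x) m) : vertex :=
  Vertex (is_word_extend u).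

Definition rooted_tree_automorphism (f : vertex -> vertex) : Prop :=
  [/\ bijective f, f root = root & forall u v, edge (f u) (f v) <-> edge u v].

Lemma edge_parent (v : vertex) : 0 < level v -> edge (parent v) v.
Proof.
case: v => w ww; rewrite /edge /parent /level /= => w0; left.
case/lastP: w w0 {ww} => // s i _; exists i.
by rewrite size_rcons /= -cats1 take_size_cat// cats1.
Qed.

Lemma edgeP (u v : vertex) : edge u v ->
  (level v = (level u).+1 /\ u = parent v) \/
  (level u = (level v).+1 /\ v = parent u).
Proof.
by case=> -[i e]; [left|right]; rewrite /level e size_rcons; split=> //;
  apply: val_inj; rewrite val_parent /level e size_rcons -cats1 take_size_cat.
Qed.

Lemma level_parent (v : vertex) : level (parent v) = (level v).-1.
Proof. by rewrite /level /= size_takel// leq_pred. Qed.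

Lemma level_eq0 (v : vertex) : level v = 0 -> v = root.
Proof. by move=> /size0nil v0; apply: val_inj. Qed.

Lemma automorphism_level_parent f (v : vertex) : rooted_tree_automorphism f ->
  level (f v) = level v /\ f (parent v) = parent (f v).
Proof.
move=> [/bij_inj finj froot fedge].
have [n] := ubnP (level v); elim: n v => // n IH v.
case lv : (level v) => [|k].
  have -> : v = root by exact: level_eq0.
  have p0 : parent root = root by apply: val_inj.
  by rewrite p0 froot p0.
rewrite ltnS => kn.
have lp : level (parent v) = k by rewrite level_parent lv.
have [|lfp fpp] := IH (parent v); first by rewrite lp.
have /fedge/edgeP : edge (parent v) v by apply: edge_parent; rewrite lv.
case=> -[e1 e2]; first by rewrite e1 lfp lp.
move: e2; rewrite -fpp => /finj /(congr1 level).
by rewrite lv !level_parent lv /= => e; move: (leq_pred k); rewrite -e ltnn.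
Qed.

Lemma automorphism_vtake f n (v : vertex) : rooted_tree_automorphism f ->
  f (vtake n v) = vtake n (f v).
Proof.
move=> fa; have [k] := ubnP (level v - n); elim: k v => // k IH v.
have [lfv fp] := automorphism_level_parent v fa.
case: (leqP (level v) n) => [vn _|nv kn].
  have -> : vtake n v = v by apply: val_inj; rewrite /= take_oversize.
  by apply: val_inj; rewrite /= take_oversize//; move: lfv; rewrite /level => ->.
have vp w : n < level w -> vtake n w = vtake n (parent w).
  move=> nw; apply: val_inj; rewrite /= take_takel// -ltnS prednK//.
  exact: leq_trans nw.
rewrite (vp v)// (vp (f v)) ?lfv// -fp IH// level_parent -subn1 subnAC subn1.
by rewrite -ltnS prednK// subn_gt0.
Qed.

End SphericallySymmetricTree.

Arguments root {d}.

Record tree_action (d : nat -> nat) (G : groupType) := TreeAction {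
  vact :> vertex d -> G -> vertex d;
  vact1 : forall v, vact v 1 = v;
  vactM : forall v g h, vact v (g * h) = vact (vact v g) h;
  vact_automorphism : forall g, rooted_tree_automorphism (vact^~ g) }.

Section Action.
Variables (d : nat -> nat) (G : groupType) (a : tree_action d G).

Definition faithful : Prop := forall g, (forall v, a v g = v) -> g = 1.

Lemma ray_act_subproof (z : ray d) (g : G) j :
  nth 0 (val (a (trunc z j.+1) g)) j < d j.
Proof.
move/is_wordP: (valP (a (trunc z j.+1) g)); apply.
have [+ _] := automorphism_level_parent (trunc z j.+1) (vact_automorphism a g).
by rewrite /level => ->; rewrite size_mkseq.
Qed.

Definition ray_act (z : ray d) (g : G) : ray d :=
  fun j => Ordinal (ray_act_subproof z g j).

Lemma trunc_ray_act (z : ray d) (g : G) n :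
  trunc (ray_act z g) n = a (trunc z n) g.
Proof.
have ga := vact_automorphism a g.
have lev m : size (val (a (trunc z m) g)) = m.
  have [+ _] := automorphism_level_parent (trunc z m) ga.
  by rewrite /level => ->; exact: size_mkseq.
apply: val_inj; apply: (@eq_from_nth _ 0); rewrite /= ?size_mkseq ?lev// => j jn.
rewrite nth_mkseq//=.
have -> : trunc z j.+1 = vtake j.+1 (trunc z n).
  by apply: val_inj; rewrite /= /mkseq -map_take take_iota (minn_idPl jn).
by rewrite (automorphism_vtake j.+1 (trunc z n) ga) /= nth_take.
Qed.

Definition Fix (H : set G) : set (ray d) :=
  [set z | forall h, H h -> ray_act z h = z].

Definition Rist (u : vertex d) : set G :=
  [set g | forall z, ~ cylinder u z -> ray_act z g = z].

(* When the action is faithful, the rigid stabilizers of distinct vertices of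
   one level commute, so the order of the factors is immaterial. *)
Definition Rist_level (m : nat) (x : vertex d) : set G :=
  [set g | exists2 f : subword d (level x) m -> G,
     (forall u, Rist (extend u) (f u)) & g = \prod_u f u].

Definition weakly_branch : Prop :=
  (forall u v, level u = level v -> exists g, a u g = v) /\
  (forall u, exists2 g, Rist u g & g <> 1).

End Action.

Section Subgroups.
Variable G : groupType.

Definition commutator_subgroup (A B : set G) : set G :=
  smallest [set K : set G | group_closed [in K]]
           [set c | exists x y, [/\ A x, B y & c = [~ x, y]]].

(* Internal direct sum of a possibly infinite family: the finite products of
   elements of distinct summands (meant for families that commute elementwise). *)
Definition direct_sum (I : eqType) (D : set I) (A : I -> set G) : set G :=
  [set g | exists (s : seq I) (f : I -> G),
     [/\ uniq s, (forall x, x \in s -> D x /\ A x (f x))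
       & g = \prod_(x <- s) f x]].

Definition subgroup_set : set {ptws G -> bool} :=
  [set H | group_closed (H : {pred G})].

(* Sub(G) with the topology induced by the product topology on {0,1}^G. *)
Definition subgroup_space : Type := set_type subgroup_set.

HB.instance Definition _ := Topological.on subgroup_space.

Definition MkSubgroup (H : {pred G}) (HG : group_closed H) : subgroup_space :=
  exist (fun K => is_true (K \in subgroup_set)) H (mem_set HG).

Lemma group_closedT : group_closed (fun _ : G => true).
Proof. by []. Qed.

HB.instance Definition _ :=
  isPointed.Build subgroup_space (MkSubgroup group_closedT).

Definition elts (H : subgroup_space) : set G := [set h | val H h].

Lemma group_closedJ (H : subgroup_space) (g : G) :
  group_closed (fun x => val H (x ^ g^-1)).
Proof.
have /set_mem [H1 HB] := valP H; split; first by rewrite /in_mem/= conj1g.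
by move=> x y Hx Hy; rewrite /in_mem/= conjMg conjVg; apply: HB.
Qed.

(* The conjugate g^-1 H g, to which x belongs iff x ^ g^-1 belongs to H. *)
Definition conj_sub (H : subgroup_space) (g : G) : subgroup_space :=
  MkSubgroup (group_closedJ H g).

Local Notation BorelSub := (g_sigma_algebraType (@open subgroup_space)).

Definition IRS (R : realType) (mu : probability BorelSub R) : Prop :=
  forall (g : G) (A : set BorelSub), measurable A ->
    mu ((conj_sub^~ g) @^-1` A) = mu A.

Definition ergodic (R : realType) (mu : probability BorelSub R) : Prop :=
  forall A : set BorelSub, measurable A ->
    (forall g : G, (conj_sub^~ g) @^-1` A = A) -> mu A = 0%E \/ mu A = 1%E.

End Subgroups.

Notation BorelSub G := (g_sigma_algebraType (@open (subgroup_space G))).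

(* Main.v *)
Require Import Defs.
From mathcomp Require Import all_boot.
From mathcomp Require Import boolp classical_sets cardinality reals ereal.
From mathcomp Require Import topology measure.

Local Open Scope classical_set_scope.

(* For h in H moving the vertex v, let P be the group of those g in Rist(v) for
   which some element of H acts as g on C_v, preserves C_(vh), and is trivial
   elsewhere. If r in Rist(v) and both h and h^r lie in H, then h^-1 h^r shows
   that r lies in P: under conjugation by Rist(v), H can return to the event
   that it contains h only along P. By invariance of mu this forces P to have
   finite index in Rist(v) almost surely.

   Let z be a point that H moves. Since Rist(v) has infinite orbits on C_v, H
   contains h and h' for which z, zh, zh' are distinct. Near z, the commutator
   of elements of H supported on C_w, C_(wh) and on C_w, C_(wh') is supported on
   C_w only, so H contains [Q, Q] for some Q of finite index in Rist(w). Passing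
   to the normal core of Q, the double commutator lemma gives
   [Rist(u), Rist(u)] <= H for some vertex u on the ray z. König's lemma makes
   the depth of u uniform over a cylinder disjoint from Fix(H), and ergodicity
   makes it independent of H and of the vertex within a level. *)

(** * Rays, descendants of a vertex and König's lemma *)

Section Tree.
#[local] Set Implicit Arguments.
#[local] Unset Strict Implicit.
#[local] Open Scope group_scope.
Variables (d : nat -> nat) (hd : forall j, 2 <= d j).

Lemma level_trunc (z : ray d) n : level (trunc z n) = n.
Proof. exact: size_mkseq. Qed.

Lemma vtake_trunc (z : ray d) n m : n <= m -> vtake n (trunc z m) = trunc z n.
Proof.
by move=> nm; apply: val_inj; rewrite /= /mkseq -map_take take_iota (minn_idPl nm).
Qed.

Lemma eq_ray_from N (z z' : ray d) :
  (forall n, N <= n -> trunc z n = trunc z' n) -> z = z'.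
Proof.
move=> zz'; apply: functional_extensionality_dep => j; apply: val_inj => /=.
have /(congr1 (fun v => nth 0 (val v) j)) := zz' (maxn N j.+1) (leq_maxl _ _).
by rewrite /= !nth_mkseq ?leq_max ?leqnn ?orbT.
Qed.

Lemma ray_neq N (z z' : ray d) : z <> z' ->
  exists2 n, N <= n & trunc z n <> trunc z' n.
Proof.
move=> zz'; apply: contrapT => h; apply: zz'; apply: (@eq_ray_from N) => n Nn.
by apply: contrapT => zn; apply: h; exists n.
Qed.

Lemma trunc_eq_le (z z' : ray d) m n : m <= n ->
  trunc z n = trunc z' n -> trunc z m = trunc z' m.
Proof. by move=> mn e; rewrite -(vtake_trunc z mn) e vtake_trunc. Qed.

(** The word of [v] is padded with the letter 0, available at every position since [2 <= d j]. *)
Lemma ray_through (v : vertex d) : exists z, cylinder v z.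
Proof.
have zP j : (if j < level v then nth 0 (val v) j else 0) < d j.
  case: ifP => [jv|_]; last exact: leq_trans (hd j).
  by move/is_wordP: (valP v); apply.
exists (fun j => Ordinal (zP j)); apply: val_inj.
apply: (@eq_from_nth _ 0); rewrite /= size_mkseq// => j jv.
by rewrite nth_mkseq//= jv.
Qed.

Lemma cylinder_trunc (z : ray d) n : cylinder (trunc z n) z.
Proof. by rewrite /cylinder /= level_trunc. Qed.

Definition below (x u : vertex d) : Prop := vtake (level x) u = x.

Lemma below_level x u : below x u -> level x <= level u.
Proof. by move=> <-; rewrite /level /= size_take_min geq_minr. Qed.

Lemma below_trans x y u : below x y -> below y u -> below x u.
Proof.
move=> xy yu; rewrite /below -[RHS]xy -[in RHS]yu; apply: val_inj => /=.
by rewrite take_takel ?below_level.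
Qed.

Lemma below_cylinder x u : below x u -> cylinder u `<=` cylinder x.
Proof.
move=> xu z uz; rewrite /cylinder /= -[RHS]xu -uz vtake_trunc//.
exact: below_level.
Qed.

Lemma below_trunc x (z : ray d) n : cylinder x z -> level x <= n ->
  below x (trunc z n).
Proof. by move=> xz xn; rewrite /below vtake_trunc. Qed.

Lemma cylinder_disjoint u w (z : ray d) : level u = level w ->
  cylinder u z -> cylinder w z -> u = w.
Proof. by move=> uw; rewrite /cylinder /= uw => -> ->. Qed.

Lemma below_extend x m (u : subword d (level x) m) :
  below x (extend u) /\ level (extend u) = level x + m.
Proof.
split; first by apply: val_inj; rewrite /= take_size_cat.
by rewrite /level /= size_cat size_map size_enum_ord.
Qed.

Lemma extend_inj x m : injective (@extend d x m).
Proof.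
move=> u w /(congr1 val) /= /eqP; rewrite eqseq_cat// eqxx /= => /eqP uw.
suff uwE (j : 'I_m) : val (u j) = val (w j) by apply/ffunP => j; exact: val_inj.
have letterE (t : subword d (level x) m) :
    nth 0 [seq val (t i) | i <- enum 'I_m] j = val (t j).
  by rewrite (nth_map j) ?size_enum_ord// nth_ord_enum.
by rewrite -!letterE uw.
Qed.

Lemma extend_surj x m (w : vertex d) : below x w -> level w = level x + m ->
  exists u : subword d (level x) m, extend u = w.
Proof.
move=> xw lw.
have uP (j : 'I_m) : nth 0 (val w) (level x + j) < d (level x + j).
  by move/is_wordP: (valP w); apply; rewrite -/(level w) lw ltn_add2l.
pose u : subword d (level x) m := [ffun j => Ordinal (uP j)].
have [xe le] := below_extend u.
exists u; apply: val_inj; apply: (@eq_from_nth _ 0).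
  by move: le lw; rewrite /level => -> ->.
move=> j; rewrite -/(level (extend u)) le => jm /=; rewrite nth_cat -/(level x).
case: (ltnP j (level x)) => jx; first by rewrite -{1}xw /= nth_take.
have jm' : j - level x < m by rewrite ltn_subLR.
have -> : j - size (val x) = Ordinal jm' by [].
rewrite (nth_map (Ordinal jm')) ?size_enum_ord// nth_ord_enum ffunE /=.
by rewrite subnKC.
Qed.

Definition hereditary (Q : vertex d -> Prop) :=
  forall u w, below u w -> Q u -> Q w.

Definition at_depth (Q : vertex d -> Prop) x m :=
  forall u, below x u -> level u = level x + m -> Q u.

Lemma at_depth_le (Q : vertex d -> Prop) x m n : hereditary Q -> m <= n ->
  at_depth Q x m -> at_depth Q x n.
Proof.
move=> Qmono mn Qm u xu lu.
have lv : level (vtake (level x + m) u) = level x + m.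
  by rewrite {1}/level /= size_takel// -/(level u) lu leq_add2l.
apply: (Qmono (vtake (level x + m) u)); first by rewrite /below lv.
apply: Qm => //; rewrite /below -[RHS]xu; apply: val_inj => /=.
by rewrite take_takel// leq_addr.
Qed.

(** A vertex without a uniform depth has a child without one, because it has finitely many children;
    iterating gives a ray along which [Q] never holds below [x]. *)
Lemma koenig (Q : vertex d -> Prop) x : hereditary Q ->
  (forall z, cylinder x z -> exists2 n, level x <= n & Q (trunc z n)) ->
  exists m, at_depth Q x m.
Proof.
move=> Qmono Qray; pose deep v := exists m, at_depth Q v m.
apply: contrapT => xdeep.
(* The hypothesis on [v] sits under the existential so that [choice] yields a total function
   [nx]. *)
have stepP v : exists w, ~ deep v -> [/\ below v w, level w = (level v).+1 & ~ deep w].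
  have [vd|vd] := pselect (deep v); first by exists v.
  apply: contrapT => nw; apply: vd.
  have /choice[f fP] : forall i : subword d (level v) 1,
      exists m, at_depth Q (extend i) m.
    move=> i; apply: contrapT => ni; apply: nw; exists (extend i) => _.
    by have [vi li] := below_extend i; split => //; rewrite li addn1.
  (* One level down to a child, then the largest depth among the children. *)
  exists (1 + \max_i f i) => u vu lu.
  have [||i iE] := @extend_surj v 1 (vtake (level v).+1 u).
  - apply: val_inj; rewrite /= take_takel//; exact: (congr1 val vu).
  - by rewrite /level /= size_takel ?addn1// -!/(level _) lu addnA addn1 leq_addr.
  have [vi li] := below_extend i.
  apply: (at_depth_le Qmono (leq_bigmax i) (fP i)).
    by rewrite /below li addn1 iE.
  by rewrite lu li addnA.
have [nx nxP] := choice stepP.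
have [v [v0 vS]] : exists v, v 0 = x /\ forall n, v n.+1 = nx (v n).
  by exists (fun n => iter n nx x).
have vP n : [/\ below x (v n), level (v n) = level x + n & ~ deep (v n)].
  elim: n => [|n [xv lv dv]].
    by rewrite v0 addn0; split => //; apply: val_inj; rewrite /= take_size.
  have [b l dn] := nxP _ dv; rewrite vS; split => //.
    exact: below_trans b.
  by rewrite l lv addnS.
have vv m n : m <= n -> below (v m) (v n).
  elim: n => [|n IH].
    by rewrite leqn0 => /eqP->; apply: val_inj; rewrite /= take_size.
  rewrite leq_eqVlt => /predU1P[->|]; first by apply: val_inj; rewrite /= take_size.
  rewrite ltnS => mn; apply: below_trans (IH mn) _.
  by rewrite vS; have [_ _ dv] := vP n; have [] := nxP _ dv.
have zP j : nth 0 (val (v j.+1)) j < d j.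
  move/is_wordP: (valP (v j.+1)); apply.
  by have [_ + _] := vP j.+1; rewrite /level => ->; rewrite addnS ltnS leq_addl.
pose z : ray d := fun j => Ordinal (zP j).
have zv n : trunc z (level x + n) = v n.
  have [_ lv _] := vP n; apply: val_inj; apply: (@eq_from_nth _ 0).
    by rewrite /= size_mkseq -lv.
  move=> j; rewrite /= size_mkseq => jn; rewrite nth_mkseq//=.
  have [_ lj _] := vP j.+1.
  have jl : j < level (v j.+1) by rewrite lj addnS ltnS leq_addl.
  case: (leqP j.+1 n) => jn'.
    by rewrite -[in LHS](vv _ _ jn') /= nth_take.
  by rewrite -[in RHS](vv _ _ (ltnW jn')) /= nth_take// lv.
have xz : cylinder x z by rewrite /cylinder /= -[X in trunc z X]addn0 zv.
have [n xn Qz] := Qray z xz.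
have [_ lv dv] := vP (n - level x); apply: dv.
exists 0 => u bu _; apply: Qmono bu _.
by rewrite -zv subnKC.
Qed.

End Tree.

(** * Subgroups as sets, commutators and finite index *)

Section Subgroups.
#[local] Set Implicit Arguments.
#[local] Unset Strict Implicit.
#[local] Open Scope group_scope.
Variable G : groupType.
Implicit Types (g h x y : G) (H K P Q R : set G).

Definition is_subgroup K := K 1 /\ forall x y, K x -> K y -> K (x * y^-1).

Lemma subgroup1 K : is_subgroup K -> K 1.
Proof. by case. Qed.

Lemma subgroupV K x : is_subgroup K -> K x -> K x^-1.
Proof. by move=> [K1 KB] Kx; rewrite -[x^-1]mul1g; exact: KB. Qed.

Lemma subgroupM K x y : is_subgroup K -> K x -> K y -> K (x * y).
Proof.
by move=> KG Kx Ky; rewrite -[y]invgK; apply: KG.2 => //; exact: subgroupV.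
Qed.

Lemma subgroupJ K x y : is_subgroup K -> K x -> K y -> K (x ^ y).
Proof.
by move=> KG Kx Ky; apply: subgroupM => //;
  [exact: subgroupV | exact: subgroupM].
Qed.

Lemma subgroupR K x y : is_subgroup K -> K x -> K y -> K [~ x, y].
Proof.
by move=> KG Kx Ky; apply: subgroupM => //; [exact: subgroupV | exact: subgroupJ].
Qed.

Lemma subgroupI H K : is_subgroup H -> is_subgroup K -> is_subgroup (H `&` K).
Proof.
move=> [H1 HB] [K1 KB]; split=> // x y [Hx Kx] [Hy Ky].
by split; [exact: HB | exact: KB].
Qed.

Lemma subgroup_prod K (I : eqType) (s : seq I) (f : I -> G) : is_subgroup K ->
  (forall i, i \in s -> K (f i)) -> K (\prod_(i <- s) f i).
Proof.
move=> KG Kf; rewrite big_seq_cond; apply: big_ind => [|x y|i /andP[si _]].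
- exact: subgroup1.
- exact: subgroupM.
- exact: Kf.
Qed.

Lemma group_closed_subgroup K : group_closed [in K] <-> is_subgroup K.
Proof.
split=> -[K1 KB]; split.
- exact/set_mem.
- by move=> x y /mem_set Kx /mem_set Ky; apply/set_mem; exact: KB.
- exact/mem_set.
- by move=> x y /set_mem Kx /set_mem Ky; apply/mem_set; exact: KB.
Qed.

Lemma commutator_subgroup_sub A B K : is_subgroup K ->
  (forall x y, A x -> B y -> K [~ x, y]) -> commutator_subgroup A B `<=` K.
Proof.
move=> KG AB; apply: smallest_sub; first exact/group_closed_subgroup.
by move=> _ [x [y [Ax By ->]]]; exact: AB.
Qed.

Lemma commuteJ x y : commute x y -> x ^ y = x.
Proof. by move=> xy; rewrite conjgE xy mulKg. Qed.

(** Primed elements commute with unprimed ones, so the commutator is computed componentwise, as in a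
    direct product. *)
Lemma commgM_commute x y x' y' : commute x' x -> commute x' y -> commute y' x ->
  commute y' y -> [~ x * x', y * y'] = [~ x, y] * [~ x', y'].
Proof.
move=> x'x x'y y'x y'y.
have cJ : commute y' (x ^ y) by apply: commuteM; [exact: commuteV | exact: commuteM].
have cR : commute [~ x, y] x'^-1.
  apply: commuteV; apply: commute_sym; apply: commuteM; first exact: commuteV.
  by apply: commuteM; [exact: commuteV | exact: commuteM].
rewrite {1}/commg conjMg !conjgM (commuteJ x'y) (commuteJ (commute_sym cJ)).
by rewrite invgM -mulgA (mulgA x^-1) mulgA -cR -mulgA.
Qed.

(** Induction by [commgM_commute]; that [f' i] commutes with [f j] is the second clause with the
    indices exchanged. *)
Lemma commg_prod (I : eqType) (s : seq I) (f f' : I -> G) : uniq s ->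
  (forall i j, i \in s -> j \in s -> i != j ->
    [/\ commute (f i) (f j), commute (f i) (f' j) & commute (f' i) (f' j)]) ->
  [~ \prod_(i <- s) f i, \prod_(i <- s) f' i] = \prod_(i <- s) [~ f i, f' i].
Proof.
elim: s => [|i s IH] /=; first by rewrite !big_nil commg1.
move=> /andP[nis us] ff; rewrite !big_cons -IH//; last first.
  by move=> j k js ks; apply: ff; rewrite inE ?js ?ks orbT.
have neq j : j \in s -> i != j by apply: contraTneq => <-.
have Cp (t : I -> G) w : (forall j, j \in s -> commute w (t j)) ->
    commute w (\prod_(j <- s) t j).
  move=> wt; rewrite big_seq_cond; apply: big_ind => [|u v|j /andP[js _]].
  - exact: commute1.
  - exact: commuteM.
  - exact: wt.
have ffi j : j \in s -> [/\ commute (f i) (f j), commute (f i) (f' j),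
    commute (f' i) (f j) & commute (f' i) (f' j)].
  move=> js; have sj : j \in i :: s by rewrite inE js orbT.
  have [c1 c2 c3] := ff i j (mem_head _ _) sj (neq _ js).
  have ji : j != i by rewrite eq_sym neq.
  have [_ c4 _] := ff j i sj (mem_head _ _) ji.
  by split => //; exact: commute_sym.
by apply: commgM_commute; apply: commute_sym; apply: Cp => j js; case: (ffi j js).
Qed.

(* A map to a finite type separating the right cosets of Q in R. *)
Definition finite_index R Q := exists (k : nat) (c : G -> 'I_k),
  forall x y, R x -> R y -> c x = c y -> Q (x * y^-1).

Lemma finite_index_of (T : finType) (c : G -> T) R Q :
  (forall x y, R x -> R y -> c x = c y -> Q (x * y^-1)) -> finite_index R Q.
Proof.
move=> cP; exists #|T|, (enum_rank \o c) => x y Rx Ry /= /enum_rank_inj.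
exact: cP.
Qed.

Lemma finite_indexI R P Q :
  finite_index R P -> finite_index R Q -> finite_index R (P `&` Q).
Proof.
move=> [k [c cP]] [l [e eP]].
apply: (@finite_index_of _ (fun x => (c x, e x))) => x y Rx Ry [cxy exy].
by split; [exact: cP | exact: eP].
Qed.

Lemma finite_index_sub R R' Q : is_subgroup R' -> R' `<=` R ->
  finite_index R Q -> finite_index R' (Q `&` R').
Proof.
move=> R'G R'R [k [c cP]]; exists k, c => x y R'x R'y cxy; split.
  by apply: cP => //; exact: R'R.
exact: R'G.2.
Qed.

(** The normal core: the intersection of [R] with the conjugates of [Q] by elements of [R]. *)
Definition core R Q : set G := [set n | R n /\ forall r, R r -> Q (n ^ r)].

(** The core is the kernel of the action of [R] on the finitely many cosets of [Q] by right
    multiplication; [x] is labelled by the classes of the translates [r i * x]. *)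
Lemma core_finite_index R Q : is_subgroup R -> is_subgroup Q ->
  finite_index R Q -> finite_index R (core R Q).
Proof.
move=> RG QG [k [c cP]].
(* [r i] represents the class [i]; 1 is a placeholder for an empty class. *)
have /choice[r rP] : forall i : 'I_k, exists r, R r /\
    ((exists2 x, R x & c x = i) -> c r = i).
  move=> i; have [[x Rx xi]|nx] := pselect (exists2 x, R x & c x = i).
    by exists x.
  by exists 1; split => //; exact: subgroup1.
apply: (@finite_index_of _ (fun x => [ffun i => c (r i * x)])) => x y Rx Ry xy.
split; first exact: RG.2.
move=> s Rs; have Rs' := subgroupV RG Rs.
have [Rri cri] := rP (c s^-1); set t := r _ in Rri cri.
have ct : c t = c s^-1 by apply: cri; exists s^-1.
have Qst : Q (s^-1 * t^-1) by apply: cP.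
have Qxy : Q ((t * x) * (t * y)^-1).
  apply: cP; [exact: subgroupM | exact: subgroupM |].
  by have /ffunP/(_ (c s^-1)) := xy; rewrite !ffunE.
have -> : (x * y^-1) ^ s = (s^-1 * t^-1) * ((t * x) * (t * y)^-1) * (s^-1 * t^-1)^-1.
  by rewrite conjgE !invgM !invgK !mulgA !mulgVK.
by apply: subgroupM => //; [exact: subgroupM | exact: subgroupV].
Qed.

Lemma core_subgroup R Q : is_subgroup R -> is_subgroup Q -> is_subgroup (core R Q).
Proof.
move=> RG QG; split.
  by split=> [|r _]; rewrite ?conj1g; exact: subgroup1.
move=> x y [Rx Qx] [Ry Qy]; split; first exact: RG.2.
by move=> r Rr; rewrite conjMg conjVg; apply: QG.2; [exact: Qx | exact: Qy].
Qed.

Lemma core_sub R Q : is_subgroup R -> core R Q `<=` Q.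
Proof. by move=> RG n [_ /(_ 1 (subgroup1 RG))]; rewrite conjg1. Qed.

Lemma coreJ R Q n r : is_subgroup R -> core R Q n -> R r -> core R Q (n ^ r).
Proof.
move=> RG [Rn Qn] Rr; split; first exact: subgroupJ.
by move=> s Rs; rewrite -conjgM; apply: Qn; exact: subgroupM.
Qed.

End Subgroups.

(** * The action on the boundary and the rigid stabilizers *)

Section Action.
#[local] Set Implicit Arguments.
#[local] Unset Strict Implicit.
#[local] Open Scope group_scope.
Variables (d : nat -> nat) (hd : forall j, 2 <= d j).
Variables (G : groupType) (a : tree_action d G).
Implicit Types (g h r : G) (u v w : vertex d) (z : ray d).

Lemma ray_act1 z : ray_act a z 1 = z.
Proof. by apply: (@eq_ray_from _ 0) => n _; rewrite trunc_ray_act vact1. Qed.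

Lemma ray_actM z g h : ray_act a z (g * h) = ray_act a (ray_act a z g) h.
Proof. by apply: (@eq_ray_from _ 0) => n _; rewrite !trunc_ray_act vactM. Qed.

Lemma ray_actK z g : ray_act a (ray_act a z g) g^-1 = z.
Proof. by rewrite -ray_actM mulgV ray_act1. Qed.

Lemma ray_actKV z g : ray_act a (ray_act a z g^-1) g = z.
Proof. by rewrite -ray_actM mulVg ray_act1. Qed.

Lemma level_act v g : level (a v g) = level v.
Proof. by have [] := automorphism_level_parent v (vact_automorphism a g). Qed.

Lemma vtake_act n v g : a (vtake n v) g = vtake n (a v g).
Proof. exact: automorphism_vtake (vact_automorphism a g). Qed.

Lemma vactK v g : a (a v g) g^-1 = v.
Proof. by rewrite -vactM mulgV vact1. Qed.

Lemma vactKV v g : a (a v g^-1) g = v.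
Proof. by rewrite -vactM mulVg vact1. Qed.

Lemma below_act x u g : below x u -> below (a x g) (a u g).
Proof. by move=> xu; rewrite /below level_act -vtake_act xu. Qed.

Lemma cylinder_act v z g : cylinder v z -> cylinder (a v g) (ray_act a z g).
Proof. by move=> vz; rewrite /cylinder /= level_act trunc_ray_act vz. Qed.

Lemma is_subgroup_Rist u : is_subgroup (Rist a u).
Proof.
split=> [z _|g h ug uh z uz]; first exact: ray_act1.
by rewrite ray_actM ug// -[in LHS](uh z uz) ray_actK.
Qed.

Lemma RistJ v r g : Rist a v r -> Rist a (a v g) (r ^ g).
Proof.
move=> vr z vz; rewrite conjgE !ray_actM vr ?ray_actKV// => vz'; apply: vz.
by rewrite -(ray_actKV z g); exact: cylinder_act.
Qed.

Lemma Rist_act u r z : Rist a u r -> cylinder u z -> cylinder u (ray_act a z r).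
Proof.
move=> ur uz; apply: contrapT => nuz.
have /(_ _ nuz) := subgroupV (is_subgroup_Rist u) ur.
by rewrite ray_actK => zE; apply: nuz; rewrite -zE.
Qed.

Lemma Rist_below x u : below x u -> Rist a u `<=` Rist a x.
Proof. by move=> xu g ug z xz; apply: ug => /(below_cylinder xu). Qed.

Lemma Rist_fixes v r : Rist a v r -> a v r = v.
Proof.
move=> vr; have [z vz] := ray_through hd v.
have := Rist_act vr vz; rewrite /cylinder /= trunc_ray_act.
by rewrite vz.
Qed.

Hypothesis ha : faithful a.

Lemma ray_faithful g h : (forall z, ray_act a z g = ray_act a z h) -> g = h.
Proof.
move=> gh; apply: (mulIg h^-1); rewrite mulgV; apply: ha => v.
have [z <-] := ray_through hd v.
by rewrite -trunc_ray_act ray_actM gh ray_actK.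
Qed.

(** Distinct cylinders of one level are disjoint, so [g] and [h] have disjoint supports. *)
Lemma Rist_commute u w g h : u <> w -> level u = level w ->
  Rist a u g -> Rist a w h -> commute g h.
Proof.
move=> neq uw ug wh; apply: ray_faithful => z; rewrite !ray_actM.
have [uz|uz] := pselect (cylinder u z).
  have nw z' : cylinder u z' -> ~ cylinder w z'.
    by move=> uz' wz'; apply: neq; exact: cylinder_disjoint uz' wz'.
  by rewrite !(wh _ (nw _ _))//; exact: Rist_act.
rewrite (ug _ uz); have [wz|wz] := pselect (cylinder w z).
  have nu z' : cylinder w z' -> ~ cylinder u z'.
    by move=> wz' uz'; apply: neq; exact: cylinder_disjoint uz' wz'.
  by rewrite ug//; apply: nu; exact: Rist_act.
by rewrite (wh _ wz) ug.
Qed.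

(** The inclusion of [Rist(u), Rist(u)] in a subgroup [H], stated on generators so that it is a
    countable, hence measurable, condition on [H]. *)
Definition Rist_derived_in (H : set G) u :=
  forall g h, Rist a u g -> Rist a u h -> H [~ g, h].

Lemma Rist_derived_in_below H : hereditary (Rist_derived_in H).
Proof. by move=> x u xu Hx g h /(Rist_below xu) ? /(Rist_below xu) ?; exact: Hx. Qed.

(** Factors at distinct vertices commute, so a commutator of two products is the product of the
    commutators of their factors. *)
Lemma Rist_level_derived H x m : is_subgroup H ->
  at_depth (Rist_derived_in H) x m ->
  commutator_subgroup (Rist_level a m x) (Rist_level a m x) `<=` H.
Proof.
move=> HG Hx; apply: commutator_subgroup_sub => // _ _ [f fP ->] [f' fP' ->].
rewrite commg_prod ?index_enum_uniq//; last first.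
  move=> u w _ _ uw.
  have neq : extend u <> extend w by move/extend_inj => e; rewrite e eqxx in uw.
  have lev : level (extend u) = level (extend w).
    by rewrite !(below_extend _).2.
  by split; apply: (Rist_commute neq lev).
apply: subgroup_prod => // u _; have [xu lu] := below_extend u.
exact: (Hx _ xu lu).
Qed.

Hypothesis hwb : weakly_branch a.

(* The points of C_v fixed by Rist(v) form a closed set invariant under the
   stabilizer of v, whose orbits in C_v are dense. *)
Lemma Rist_moves v z : cylinder v z -> exists2 r, Rist a v r & ray_act a z r <> z.
Proof.
move=> vz; apply: contrapT => nr.
have fixz r : Rist a v r -> ray_act a z r = z.
  by move=> vr; apply: contrapT => zr; apply: nr; exists r.
have [r vr r1] := hwb.2 v; apply: r1.
apply: ray_faithful => y; rewrite ray_act1.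
have [vy|/vr//] := pselect (cylinder v y).
apply: (@eq_ray_from _ (level v)) => n vn.
have [|g zgy] := hwb.1 (trunc z n) (trunc y n); first by rewrite !level_trunc.
have vg : a v g = v.
  by rewrite -[in LHS]vz -(vtake_trunc z vn) vtake_act zgy vtake_trunc.
(* This conjugate fixes [z], so [r] fixes the image of [z] under [g], which agrees with [y] up to
   level [n]. *)
have vr' : Rist a v (r ^ g^-1).
  by rewrite -[v](vactK _ g) vg; exact: RistJ.
rewrite trunc_ray_act -zgy -vactM -trunc_ray_act -[in RHS](fixz _ vr').
by rewrite -trunc_ray_act -ray_actM conjgE invgK !mulgA mulgVK.
Qed.

(** If [Q] fixed [z], elements of one class would send [z] to one point, so [z] would have finitely
    many images under Rist(v). Elements of Rist at a deep enough vertex of [z] move [z] to a point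
    closer than all of these. *)
Lemma finite_index_moves v z (Q : set G) : is_subgroup Q -> cylinder v z ->
  finite_index (Rist a v) Q -> exists2 r, Q r & ray_act a z r <> z.
Proof.
move=> QG vz [k [c cP]]; apply: contrapT => nr.
have fixz r : Q r -> ray_act a z r = z.
  by move=> Qr; apply: contrapT => zr; apply: nr; exists r.
(* [t i] is a level separating [z] from its image under the class [i], and 0 if that class does not
   move [z]. *)
have /choice[t tP] : forall i : 'I_k, exists t, forall r, Rist a v r -> c r = i ->
    ray_act a z r <> z -> trunc (ray_act a z r) t <> trunc z t.
  move=> i; have [[r [vr ri zr]]|nri] :=
    pselect (exists r, [/\ Rist a v r, c r = i & ray_act a z r <> z]).
    have [t _ zt] := ray_neq 0 zr; exists t => s vs si _.
    suff -> : ray_act a z s = ray_act a z r by [].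
    have /fixz : Q (r * s^-1) by apply: cP => //; rewrite si.
    by rewrite ray_actM => e; rewrite -[in LHS]e ray_actKV.
  by exists 0 => r vr ri zr; exfalso; apply: nri; exists r.
pose n := maxn (level v) (\max_i t i).
have vn : below v (trunc z n) by apply: below_trunc => //; exact: leq_maxl.
have [r nr' zr] := Rist_moves (cylinder_trunc z n).
apply: (tP (c r) r) => //; first exact: Rist_below nr'.
apply: (@trunc_eq_le _ _ _ _ n).
  by rewrite leq_max (leq_bigmax (c r)) orbT.
by rewrite trunc_ray_act Rist_fixes.
Qed.

(* The action on C_v of those elements of H that are supported on the union of
   C_v and C_(vh) and preserve both cylinders. *)
Definition Rist_proj (H : set G) v h : set G :=
  [set g | Rist a v g /\ exists2 b, Rist a (a v h) b & H (b * g)].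

(** As [v] and its image under [h] differ, the two components of an element commute, and quotients
    are taken componentwise. *)
Lemma Rist_proj_subgroup H v h : is_subgroup H -> a v h <> v ->
  is_subgroup (Rist_proj H v h).
Proof.
move=> HG vh; have vG := is_subgroup_Rist v; have vhG := is_subgroup_Rist (a v h).
split.
  split; first exact: subgroup1.
  by exists 1; rewrite ?mulg1; exact: subgroup1.
move=> x y [vx [b vb Hbx]] [vy [b' vb' Hby]]; split; first exact: vG.2.
exists (b * b'^-1); first exact: vhG.2.
have C : commute b'^-1 (x * y^-1).
  by apply: (Rist_commute vh); [rewrite level_act | exact: (subgroupV vhG) | exact: vG.2].
have -> : b * b'^-1 * (x * y^-1) = (b * x) * (b' * y)^-1.
  by rewrite -mulgA C invgM !mulgA.
exact: HG.2.
Qed.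

(** The one almost sure property on which the deterministic arguments about a single subgroup [H]
    rest. *)
Definition Rist_proj_large (H : set G) :=
  forall v h, H h -> a v h <> v -> finite_index (Rist a v) (Rist_proj H v h).

(** * Derived rigid stabilizers inside one fixed subgroup *)

Section Local.
Variables (H : set G) (HG : is_subgroup H) (Hlarge : Rist_proj_large H).

Lemma finite_index_derived z h : H h -> ray_act a z h <> z ->
  exists n (Q : set G), [/\ is_subgroup Q, finite_index (Rist a (trunc z n)) Q &
    forall x y, Q x -> Q y -> H [~ x, y]].
Proof.
move=> Hh zh.
have [n _ zhn] := ray_neq 0 zh; rewrite trunc_ray_act in zhn.
set v := trunc z n in zhn.
have PG := Rist_proj_subgroup HG zhn.
have vz : cylinder v z by exact: cylinder_trunc.
(* Since [b] fixes [z], the lift [b * g] moves [z] as [g] does, within C_v, whereas [h] takes [z]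
   out of C_v. *)
have [g [vg [b vhb Hh']] zg] := finite_index_moves PG vz (Hlarge Hh zhn).
set h' := b * g in Hh'.
have zh'E : ray_act a z h' = ray_act a z g.
  rewrite ray_actM vhb// => vhz; apply: zhn.
  by apply: cylinder_disjoint vhz vz; rewrite level_act.
have zh' : ray_act a z h' <> z by rewrite zh'E.
have vzh' : cylinder v (ray_act a z h') by rewrite zh'E; exact: Rist_act.
(* At this depth [w] and its images under [h] and [h'] are three distinct vertices. *)
have [m nm zm] := ray_neq n zh'; rewrite trunc_ray_act in zm.
set w := trunc z m in zm.
have wh : a w h <> w.
  by move=> e; apply: zhn; rewrite /v -(vtake_trunc z nm) vtake_act e.
have whh' : a w h <> a w h'.
  move=> e; apply: zhn; rewrite /v -[in LHS](vtake_trunc z nm) vtake_act e.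
  by rewrite -trunc_ray_act vtake_trunc//; move: vzh'; rewrite /cylinder /= level_trunc.
exists m, (Rist_proj H w h `&` Rist_proj H w h'); split.
- by apply: subgroupI; exact: Rist_proj_subgroup.
- by apply: finite_indexI; exact: Hlarge.
move=> x y [[wx [b1 wb1 Hx]] _] [_ [wy [b2 wb2 Hy]]].
have := subgroupR HG Hx Hy.
have C u t c e : u <> t -> level u = level t -> Rist a u c -> Rist a t e -> commute e c.
  by move=> neq lev uc te; apply: commute_sym; exact: (Rist_commute neq lev).
(* The supports of [b1 * x] and [b2 * y] meet only in C_w, so just [[~ x, y]] survives. *)
rewrite commgM_commute.
- have -> : [~ b1, b2] = 1.
    by apply/eqP/commgP; apply: (Rist_commute whh'); rewrite ?level_act.
  by rewrite mul1g.
- by apply: (C _ _ _ _ wh); rewrite ?level_act.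
- by apply: (C _ _ _ _ zm); rewrite ?level_act.
- by apply: (C _ _ _ _ wh); rewrite ?level_act.
- by apply: (C _ _ _ _ zm); rewrite ?level_act.
Qed.

(** Double commutator argument: [k] in [N, N] moves a vertex [u] of [z], and then [x, y] = [[k, x],
    y] for [x], [y] in Rist(u). Normality of [N] puts the right side in [H]. *)
Lemma Rist_derived_near z h : H h -> ray_act a z h <> z ->
  exists n, Rist_derived_in H (trunc z n).
Proof.
move=> Hh zh; have [n [Q [QG Qfin QH]]] := finite_index_derived Hh zh.
set v := trunc z n in Qfin; have vG := is_subgroup_Rist v.
have NG := core_subgroup vG QG; have Nfin := core_finite_index vG QG Qfin.
set N := core _ _ in NG Nfin.
have NQ x : N x -> Q x by exact: core_sub.
have [s Ns zs] := finite_index_moves NG (cylinder_trunc z n) Nfin.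
have [m nm zsm] := ray_neq n zs; set w := trunc z m.
have vw : below v w by apply: below_trunc; rewrite ?level_trunc//; exact: cylinder_trunc.
have [t [Nt wt] zt] : exists2 t, (N `&` Rist a w) t & ray_act a z t <> z.
  have wG := is_subgroup_Rist w.
  apply: finite_index_moves (cylinder_trunc z m) _; first exact: subgroupI.
  exact: finite_index_sub (Rist_below vw) Nfin.
(* [t] alone need not lie in [H], but commutators of elements of [N] do; [s] is there so that [k]
   still moves [z]. *)
pose k := [~ s, t].
(* [z s^-1] lies outside [C_w], hence is fixed by [t]. *)
have zk : ray_act a z k = ray_act a z t.
  rewrite /k /commg conjgE !ray_actM; congr (ray_act a _ t).
  rewrite (subgroupV (is_subgroup_Rist w) wt) ?ray_actKV// => wzs; apply: zsm.
  move: (cylinder_act s wzs); rewrite ray_actKV /cylinder /= level_act level_trunc.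
  by rewrite trunc_ray_act => <-.
have zk' : ray_act a z k <> z by rewrite zk.
have [l ml zkl] := ray_neq m zk'; rewrite trunc_ray_act in zkl.
set u := trunc z l in zkl.
have vu : below v u.
  by apply: below_trunc; rewrite ?level_trunc ?(leq_trans nm ml)//; exact: cylinder_trunc.
have HkJ r : Rist a u r -> H (k ^ r).
  move=> /(Rist_below vu) vr; rewrite conjRg; apply: QH; apply: NQ; exact: coreJ.
exists l => x y ux uy.
have ukx : Rist a (a u k) ((x^-1) ^ k).
  by apply: RistJ; apply: subgroupV ux; exact: is_subgroup_Rist.
have C c : Rist a u c -> commute ((x^-1) ^ k) c.
  by move=> uc; apply: (Rist_commute zkl); rewrite ?level_act.
(* In [k, x] = (x^-1)^k x the first factor is supported off C_u and commutes with [x] and [y]. *)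
have -> : [~ x, y] = [~ [~ k, x], y].
  rewrite [[~ k, x]]commgEr.
  have := @commgM_commute _ (x^-1 ^ k) 1 x y; rewrite !mul1g commg1 mul1g => ->//.
  - exact: commute_sym (C _ ux).
  - exact: commute1.
  - exact: commute_sym (C _ uy).
  - exact: commute1.
have uG := is_subgroup_Rist u.
(* [x] need not lie in [H], but [k, x]^c is the quotient of two conjugates of [k] that do. *)
have Hkx c : Rist a u c -> H ([~ k, x] ^ c).
  move=> uc; rewrite /commg conjMg conjVg -conjgM.
  apply: (subgroupM HG); first by apply: (subgroupV HG); exact: HkJ.
  by apply: HkJ; exact: (subgroupM uG).
apply: (subgroupM HG); last exact: Hkx.
by rewrite -[[~ k, x]]conjg1; apply: (subgroupV HG); apply: Hkx; exact: subgroup1.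
Qed.

(** [H] moves every ray of C_x, so each one carries a vertex from [Rist_derived_near], and König's
    lemma bounds the depth. *)
Lemma max_cylinder_derived x : max_cylinders (Fix a H) x ->
  exists m, at_depth (Rist_derived_in H) x m.
Proof.
move=> [xFix _]; apply: koenig (@Rist_derived_in_below H) _ => z xz.
have [h Hh zh] : exists2 h, H h & ray_act a z h <> z.
  apply: contrapT => nh; have : (cylinder x `&` Fix a H) z.
    by split=> // h Hh; apply: contrapT => zh; apply: nh; exists h.
  by rewrite xFix.
have [n Hn] := Rist_derived_near Hh zh.
exists (maxn (level x) n); first exact: leq_maxl.
apply: Rist_derived_in_below Hn.
by apply: below_trunc; [exact: cylinder_trunc | rewrite level_trunc leq_maxr].
Qed.

End Local.

End Action.

(** * Measurability of countable logical combinations of events *)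

Section Measurability.
#[local] Set Implicit Arguments.
#[local] Unset Strict Implicit.

Lemma countable_enum (T : Type) (x0 : T) : countable [set: T] ->
  exists f : nat -> T, forall x, exists n, f n = x.
Proof.
move=> /countable_injP[e einj].
(* A left inverse of [e], with value [x0] permitted off the range of [e]. *)
have /choice[f fP] : forall n, exists x, forall y, e y = n -> e x = n.
  move=> n; have [[x xn]|nx] := pselect (exists x, e x = n); first by exists x.
  by exists x0 => y yn; exfalso; apply: nx; exists y.
exists f => x; exists (e x); apply: einj; rewrite ?in_setT//; exact: fP erefl.
Qed.

Context {dT : measure_display} {T : measurableType dT}.

(** Serves for conditions that do not involve the random subgroup, such as membership in a rigid
    stabilizer. *)
Lemma measurable_const (P : Prop) : measurable [set _ : T | P].
Proof.
have [p|np] := pselect P.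
  by rewrite (_ : [set _ | P] = setT)//; apply/seteqP; split.
by rewrite (_ : [set _ | P] = set0)//; apply/seteqP; split.
Qed.

Lemma measurable_imply (A B : T -> Prop) : measurable [set x | A x] ->
  measurable [set x | B x] -> measurable [set x | A x -> B x].
Proof.
move=> mA mB; rewrite (_ : [set x | A x -> B x] = ~` [set x | A x] `|` [set x | B x]).
  by apply: measurableU => //; exact: measurableC.
by apply/predeqP => x /=; rewrite implyE.
Qed.

Lemma measurable_forall (I : Type) (i0 : I) (A : I -> T -> Prop) :
  countable [set: I] -> (forall i, measurable [set x | A i x]) ->
  measurable [set x | forall i, A i x].
Proof.
move=> /(countable_enum i0)[f fsurj] mA.
rewrite (_ : [set x | _] = \bigcap_n [set x | A (f n) x]).
  by apply: bigcapT_measurable => n; exact: mA.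
apply/seteqP; split=> x /= Ax; first by move=> n _; exact: Ax.
by move=> i; have [n <-] := fsurj i; exact: Ax.
Qed.

Lemma measurable_exists (I : Type) (i0 : I) (A : I -> T -> Prop) :
  countable [set: I] -> (forall i, measurable [set x | A i x]) ->
  measurable [set x | exists i, A i x].
Proof.
move=> /(countable_enum i0)[f fsurj] mA.
rewrite (_ : [set x | _] = \bigcup_n [set x | A (f n) x]).
  by apply: bigcupT_measurable => n; exact: mA.
apply/seteqP; split=> x /=; last by move=> [n _ Ax]; exists (f n).
by move=> [i]; have [n <-] := fsurj i; exists n.
Qed.

Lemma ae_forall_countable (R : realType) (mu : probability T R)
    (I : Type) (i0 : I) (P : I -> T -> Prop) : countable [set: I] ->
  (forall i, {ae mu, forall x, P i x}) -> {ae mu, forall x, forall i, P i x}.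
Proof.
move=> /(countable_enum i0)[f fsurj] Pi.
have := ae_foralln (fun n => Pi (f n)).
by apply: filterS => x Px i; have [n <-] := fsurj i.
Qed.

End Measurability.

(** * The Borel structure on the space of subgroups *)

Section SubgroupSpace.
#[local] Set Implicit Arguments.
#[local] Unset Strict Implicit.
#[local] Open Scope group_scope.
Variable G : groupType.
Implicit Types (H : BorelSub G) (g h : G).

(** The set is open: evaluation at [g] is continuous for the product topology and {true} is open. *)
Lemma measurable_elts g : measurable [set H : BorelSub G | elts H g].
Proof.
apply: sub_sigma_algebra.
pose ev (K : {ptws G -> bool}) := K g.
have -> : [set H : BorelSub G | elts H g] =
    (val : subgroup_space G -> {ptws G -> bool}) @^-1` (ev @^-1` [set true]).
  by apply/seteqP; split.
apply: open_comp.
  by move=> x _; exact: initial_continuous.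
apply: open_comp; last exact: discrete_open.
by move=> x _; exact: (@proj_continuous _ _ g).
Qed.

Lemma elts_conj H g x : elts (conj_sub H g) x = elts H (x ^ g^-1).
Proof. by []. Qed.

Lemma elts_subgroup H : is_subgroup (elts H).
Proof.
have [H1 HB] := set_mem (valP H); split; first exact: H1.
by move=> x y; exact: HB.
Qed.

End SubgroupSpace.

(** * Consequences of invariance and ergodicity *)

Section InvariantRandomSubgroup.
#[local] Set Implicit Arguments.
#[local] Unset Strict Implicit.
#[local] Open Scope group_scope.
Variables (R : realType) (d : nat -> nat) (hd : forall j, 2 <= d j).
Variables (G : groupType) (hG : countable [set: G]).
Variables (a : tree_action d G) (ha : faithful a).
Variables (mu : probability (BorelSub G) R).
Implicit Types (H : BorelSub G) (g h : G) (u v : vertex d).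

(** The parameter [phi] covers both [H] and its conjugates. *)
Lemma measurable_Rist_proj (phi : BorelSub G -> set G) v h g :
  (forall c, measurable [set H | phi H c]) ->
  measurable [set H | Rist_proj a (phi H) v h g].
Proof.
move=> mphi; rewrite (_ : mkset _ = [set _ | Rist a v g] `&`
    [set H | exists b, Rist a (a v h) b /\ phi H (b * g)]).
  apply: measurableI; first exact: measurable_const.
  apply: (measurable_exists (1 : G) hG) => b.
  by apply: measurableI; [exact: measurable_const | exact: mphi].
apply/predeqP => H; split=> [[vg [b vb Hb]]|[vg [b [vb Hb]]]]; split=> //.
  by exists b.
by exists b.
Qed.

(** h^-1 h^r = (r^-1)^h r lies in [K], and its first factor is in the rigid stabilizer of the image
    of [v] under [h]. *)
Lemma Rist_proj_return (K : set G) v h r : is_subgroup K ->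
  Rist a v r -> K h -> K (h ^ r) -> Rist_proj a K v h r.
Proof.
move=> KG vr Kh Khr; split => //; exists ((r^-1) ^ h).
  by apply: RistJ; apply: subgroupV vr; exact: is_subgroup_Rist.
have -> : (r^-1) ^ h * r = h^-1 * h ^ r by rewrite !conjgE !mulgA.
by apply: subgroupM => //; exact: subgroupV.
Qed.

Hypothesis hmu : IRS mu.

(* [E n]: the nth element of G lies in Rist(v) and is the first of its coset of
   Rist_proj. The conjugates of the [E n] by these elements are disjoint, as a
   return of H to the event [h \in H] under Rist(v) can only happen along
   Rist_proj. Hence the measures of the [E n] are summable, and Borel-Cantelli
   applies. *)
Lemma ae_finite_index v h : a v h <> v ->
  {ae mu, forall H, elts H h ->
    finite_index (Rist a v) (Rist_proj a (elts H) v h)}.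
Proof.
move=> vh; have [f fsurj] := countable_enum (1 : G) hG.
have vG := is_subgroup_Rist a v.
pose first n (K : set G) := K h /\ Rist a v (f n) /\
  forall i, i < n -> Rist a v (f i) -> ~ Rist_proj a K v h (f n * (f i)^-1).
have mfirst n (phi : BorelSub G -> set G) : (forall c, measurable [set H | phi H c]) ->
    measurable [set H | first n (phi H)].
  move=> mphi; apply: measurableI; first exact: mphi.
  apply: measurableI; first exact: measurable_const.
  apply: (measurable_forall 0) => [|i]; first exact: countableP.
  apply: measurable_imply; first exact: measurable_const.
  apply: measurable_imply; first exact: measurable_const.
  by apply: measurableC; exact: measurable_Rist_proj.
pose E n : set (BorelSub G) := [set H | first n (elts H)].
pose F n : set (BorelSub G) := [set H | first n (elts (conj_sub H (f n)^-1))].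
have mE n : measurable (E n) by apply: mfirst; exact: measurable_elts.
have mF n : measurable (F n) by apply: mfirst => c; exact: measurable_elts.
have EF n : mu (E n) = mu (F n) by rewrite -(hmu (f n)^-1 (mE n)).
(* In the conjugate [K] of [H] by (f n)^-1, both [h] and its conjugate by f i (f n)^-1 occur; this
   return makes f n and f i represent the same coset, against the choice of f n as first. *)
have disj i n H : i < n -> F n H -> F i H -> False.
  move=> ltin [Hn [vn Hfirst]] [Hi [vi _]].
  have KG := elts_subgroup (conj_sub H (f n)^-1).
  set K := elts _ in Hn Hfirst KG.
  have vr : Rist a v (f i * (f n)^-1) by exact: vG.2.
  apply: (Hfirst _ ltin vi).
  rewrite -[f n * _]invgK invgM invgK; apply: subgroupV.
    exact: Rist_proj_subgroup.
  apply: Rist_proj_return => //.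
  rewrite /K elts_conj -conjgM invgK mulgVK.
  by move: Hi; rewrite elts_conj invgK.
have tF : trivIset setT F.
  apply/trivIsetP => i n _ _; rewrite neq_ltn => /orP[] lt.
  - by apply/seteqP; split=> // H [Fi Fn]; exact: (disj _ _ _ lt Fn Fi).
  - by apply/seteqP; split=> // H [Fi Fn]; exact: (disj _ _ _ lt Fi Fn).
(* The series of measures sums to the measure of the disjoint union of the [F n], which is
   finite. *)
have limE : mu (lim_sup_set E) = 0%E.
  apply: lim_sup_set_cvg0 => //.
  rewrite (_ : (fun n0 : nat => _) = (fun n0 : nat => (\sum_(0 <= n < n0) mu (F n))%R)).
    rewrite -measure_semi_bigcup//; last exact: bigcupT_measurable.
    by rewrite -ge0_fin_numE ?fin_num_measure//; exact: bigcupT_measurable.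
  by apply/funext => n0; apply: eq_bigr => n _; exact: EF.
exists (lim_sup_set E); split=> //.
  by apply: bigcapT_measurable => n; apply: bigcup_measurable.
(* If no [E i] with [n <= i] occurs, each coset has its first representative below [n], so the index
   is finite. *)
move=> H /= /not_implyP[Hh nfin] n _; apply: contrapT => nE; apply: nfin.
have HG := elts_subgroup H; set P := Rist_proj _ _ _ _.
have PG : is_subgroup P by exact: Rist_proj_subgroup.
have rep x : Rist a v x -> exists i, [/\ i < n, Rist a v (f i) & P (x * (f i)^-1)].
  move=> vx.
  pose good i := `[< Rist a v (f i) /\ P (x * (f i)^-1) >].
  have ex : exists i, good i.
    have [i fi] := fsurj x; exists i; apply/asboolP; rewrite fi mulgV.
    by split => //; exact: subgroup1.
  have [i /asboolP[vi Pi] imin] := ex_minnP ex.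
  exists i; split=> //; rewrite ltnNge; apply/negP => ni.
  apply: nE; exists i => //; split => //; split => // j ji vj Pij.
  have : good j.
    apply/asboolP; split => //.
    by rewrite -[x](mulgVK (f i)) -mulgA; exact: subgroupM.
  by move=> /imin; rewrite leqNgt ji.
(* The coset of 1 has a representative, so [n] is positive and [ord0] can serve as a default
   below. *)
have [n0|n0] := posnP n.
  by have [i []] := rep 1 (subgroup1 vG); rewrite n0.
case: n n0 {nE} rep => // n _ rep.
have /choice[c cP] : forall x, exists i : 'I_n.+1, Rist a v x ->
    Rist a v (f i) /\ P (x * (f i)^-1).
  move=> x; have [vx|nx] := pselect (Rist a v x); last by exists ord0.
  by have [i [lt vi Pi]] := rep x vx; exists (Ordinal lt).
exists n.+1, c => x y vx vy cxy.
have [_ Px] := cP _ vx; have [_ Py] := cP _ vy; rewrite cxy in Px.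
have -> : x * y^-1 = (x * (f (c y))^-1) * (y * (f (c y))^-1)^-1.
  by rewrite invgM invgK !mulgA mulgVK.
exact: PG.2.
Qed.

Lemma ae_Rist_proj_large :
  {ae mu, forall H, Rist_proj_large a (elts H)}.
Proof.
apply: (ae_forall_countable (@Defs.root d)) => [|v]; first exact: countableP.
apply: (ae_forall_countable (1 : G)) => // h.
have [vh|vh] := pselect (a v h = v); first by apply: aeW => H _ /(_ vh).
by apply: filterS (ae_finite_index vh) => H HP Hh _; exact: HP.
Qed.

Local Notation derived_below H := (at_depth (Rist_derived_in a (elts H))).

Lemma derived_below_conj H g v m :
  derived_below H v m -> derived_below (conj_sub H g) (a v g) m.
Proof.
move=> Hv u vu lu x y ux uy; rewrite elts_conj conjRg.
apply: (Hv (a u g^-1)); last 2 first; [exact: RistJ | exact: RistJ | |].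
- by have := below_act a g^-1 vu; rewrite vactK.
- by rewrite level_act lu level_act.
Qed.

Lemma derived_below_conjE H g v m :
  derived_below (conj_sub H g) (a v g) m <-> derived_below H v m.
Proof.
split; last exact: derived_below_conj.
move=> /(derived_below_conj (g := g^-1)); rewrite vactK.
suff -> : conj_sub (conj_sub H g) g^-1 = H by [].
by apply: val_inj; apply/funext => x /=; rewrite invgK conjgK.
Qed.

Lemma measurable_derived_below v m :
  measurable [set H : BorelSub G | derived_below H v m].
Proof.
apply: (measurable_forall (@Defs.root d)) => [|u]; first exact: countableP.
do 2 (apply: measurable_imply; first exact: measurable_const).
do 2 apply: (measurable_forall (1 : G)) => // ?.
do 2 (apply: measurable_imply; first exact: measurable_const).
exact: measurable_elts.
Qed.

Hypothesis herg : ergodic mu.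

(** Conjugation permutes the vertices of level [n], so each [D m] is invariant and has measure 0 or
    1. The [D m] cover everything, as a level is finite, so one has measure 1. Conditioning on the
    existence of some depth [k] keeps Fix(H) out of the event. *)
Lemma ae_uniform_depth n : exists m, {ae mu, forall H v k, level v = n ->
  derived_below H v k -> derived_below H v m}.
Proof.
pose D m : set (BorelSub G) := [set H | forall v k, level v = n ->
  derived_below H v k -> derived_below H v m].
have mD m : measurable (D m).
  apply: (measurable_forall (@Defs.root d)) => [|v]; first exact: countableP.
  apply: (measurable_forall 0) => [|k]; first exact: countableP.
  apply: measurable_imply; first exact: measurable_const.
  by apply: measurable_imply; exact: measurable_derived_below.
have invD m g : ((@conj_sub G)^~ g) @^-1` D m = D m.
  apply/predeqP => H; split=> Hm v k vn.
    move=> /(derived_below_conj (g := g)) /Hm/derived_below_conjE; apply.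
    by rewrite level_act.
  rewrite -[v](vactKV a _ g) => /derived_below_conjE /Hm vk.
  by apply/derived_below_conjE/vk; rewrite level_act.
have [m Dm1] : exists m, mu (D m) = 1%E.
  apply: contrapT => nD.
  have D0 m : mu.-negligible (D m).
    apply/negligibleP => //.
    by have [//|D1] := herg (mD m) (invD m); exfalso; apply: nD; exists m.
  have : mu.-negligible (\bigcup_m D m) by exact: negligible_bigcup.
  suff -> : \bigcup_m D m = setT.
    move=> /(negligibleP mu measurableT) mu0.
    by have /eqP := etrans (esym (probability_setT mu)) mu0; rewrite onee_eq0.
  apply/seteqP; split=> // H _.
  (* Vertices admitting no depth satisfy the implication vacuously and receive 0. *)
  have /choice[f fP] : forall u : subword d (level (@Defs.root d)) n, exists m, forall k,
      derived_below H (extend u) k -> derived_below H (extend u) m.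
    move=> u; have [[m um]|nm] := pselect (exists m, derived_below H (extend u) m).
      by exists m.
    by exists 0 => k uk; exfalso; apply: nm; exists k.
  exists (\max_u f u) => // v k vn vk.
  have [||u uE] := @extend_surj d (@Defs.root d) n v => //.
    by apply: val_inj; exact: take0.
  rewrite -uE; apply: at_depth_le (leq_bigmax u) _; first exact: Rist_derived_in_below.
  by apply: fP; rewrite uE; exact: vk.
exists m; exists (~` D m); split => //; first exact: measurableC.
by rewrite probability_setC// Dm1 subee.
Qed.

End InvariantRandomSubgroup.

Theorem corollary1p5 (R : realType) (d : nat -> nat) (hd : forall j, 2 <= d j)
    (G : groupType) (hG : countable [set: G])
    (a : tree_action d G) (ha : faithful a) (hwb : weakly_branch a)
    (mu : probability (BorelSub G) R) (hmu : IRS mu) (herg : ergodic mu) :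
  exists m : nat -> nat,
    {ae mu, forall H : BorelSub G,
      direct_sum (max_cylinders (Fix a (elts H)))
        (fun x => commutator_subgroup (Rist_level a (m (level x)) x)
                                      (Rist_level a (m (level x)) x))
      `<=` elts H}.
Proof.
(* One depth per level; there are countably many levels, so almost surely all these depths are valid
   together. *)
have [m mP] := choice (ae_uniform_depth hG a herg).
exists m; move: (ae_Rist_proj_large hd hG ha hmu) (ae_foralln mP).
apply: filterS2 => H Hlarge Hm _ [s [f [_ fP ->]]].
have HG := elts_subgroup H.
apply: subgroup_prod => // x /fP[xFix].
apply: (Rist_level_derived hd ha HG).
have [k xk] := max_cylinder_derived hd ha hwb HG Hlarge xFix.
exact: Hm xk.
Qed.
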